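(* Let $x: M \rightarrow \mathbb{E}^m$ be an isometric immersion of a connected Riemannian surface into $\mathbb{E}^m$. If the Laplace transformation $\mathcal{L} :M \rightarrow L(M)$ is conformal, then the Laplace image $L(M)$ (with respect to its induced metric) is a minimal surface of $\mathbb{E}^m$ via $L$ if and only if the immersion $x$ is biharmonic.
   Context: Manifolds and immersions are smooth and connected. $\Delta=-\operatorname{trace}\nabla^2$ is the Laplace operator of $M$. The Laplace map is $L:M\to\mathbb{E}^m$, $L(p)=(\Delta x)(p)=-2H(p)$ with $H=\frac12\operatorname{trace}h$ the mean curvature vector; the Laplace transformation $\mathcal L:M\to L(M)$ is $L$ regarded as a map onto its image. $\mathcal L$ is conformal if there is a strictly positive function $\rho$ on $M$ with $\langle dL(X),dL(Y)\rangle=\rho^2\langle X,Y\rangle$ for all tangent vectors $X,Y$ at a common point; then $L$ is an immersion, and minimality of the Laplace image is understood for the immersion $L$ with the metric it induces on $M$. The immersion $x$ is biharmonic if $\Delta^2x=0$, equivalently $\Delta H=0$. *)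

(* Defs.v *)
From HB Require Import structures.
From mathcomp Require Import all_boot all_order all_algebra.
From mathcomp Require Import all_classical all_reals topology normedtype derive.

Set Implicit Arguments.
Unset Strict Implicit.
Unset Printing Implicit Defensive.

Import Order.TTheory GRing.Theory Num.Theory.
Import numFieldNormedType.Exports.

Local Open Scope classical_set_scope.
Local Open Scope ring_scope.

(** * Smooth maps between open subsets of Euclidean spaces *)

(* The norm carried by ['rV[R]_m] is the sup norm; the Euclidean inner product
   is therefore introduced separately. *)
Definition dotv (R : realType) (m : nat) (u v : 'rV[R]_m) : R :=
  \sum_(k < m) u 0 k * v 0 k.

(* In finite dimension, [u |-> 'd f u] is C^k iff all the directional
   derivatives ['D_v f] are. *)
Fixpoint Ck_on (R : realType) (n : nat) (W : normedModType R) (k : nat)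
    (U : set 'rV[R]_n) (f : 'rV[R]_n -> W) : Prop :=
  match k with
  | 0 => forall u, U u -> {for u, continuous f}
  | k'.+1 => (forall u, U u -> differentiable f u) /\
             (forall v, Ck_on k' U ('D_v f))
  end.

Definition smooth_on (R : realType) (n : nat) (W : normedModType R)
    (U : set 'rV[R]_n) (f : 'rV[R]_n -> W) : Prop :=
  forall k, Ck_on k U f.

(** * Smooth manifolds *)

(* A homeomorphism from an open set of [T] onto an open set of R^n;
   [chart_map] and [chart_inv] are irrelevant outside of these open sets. *)
Record chart (R : realType) (n : nat) (T : topologicalType) := Chart {
  chart_dom : set T ;
  chart_map :> T -> 'rV[R]_n ;
  chart_inv : 'rV[R]_n -> T ;
  chart_dom_open : open chart_dom ;
  chart_cod_open : open (chart_map @` chart_dom) ;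
  chart_mapK : forall p, chart_dom p -> chart_inv (chart_map p) = p ;
  chart_map_continuous :
    forall p, chart_dom p -> {for p, continuous chart_map} ;
  chart_inv_continuous :
    forall u, (chart_map @` chart_dom) u -> {for u, continuous chart_inv}
}.

Definition chart_cod (R : realType) (n : nat) (T : topologicalType)
  (phi : chart R n T) : set 'rV[R]_n := phi @` chart_dom phi.

Record manifold (R : realType) (n : nat) := Manifold {
  points :> topologicalType ;
  atlas : set (chart R n points) ;
  manifold_hausdorff : hausdorff_space points ;
  manifold_second_countable : @second_countable points ;
  manifold_connected : connected [set: points] ;
  atlas_cover : forall p, exists2 phi, atlas phi & chart_dom phi p ;
  atlas_smooth : forall phi psi, atlas phi -> atlas psi ->
    smooth_on (phi @` (chart_dom phi `&` chart_dom psi))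
              (psi \o chart_inv phi)
}.

Definition chart_at (R : realType) (n : nat) (M : manifold R n) (p : M)
  : chart R n M := s2val (cid2 (atlas_cover p)).

Definition smooth_map (R : realType) (n : nat) (M : manifold R n)
    (W : normedModType R) (f : M -> W) : Prop :=
  forall phi, atlas phi -> smooth_on (chart_cod phi) (f \o chart_inv phi).

(* Tangent vectors at [p] are represented by their components [X] in a chart
   [phi] around [p]. *)
Definition differential (R : realType) (n : nat) (T : topologicalType)
    (W : normedModType R) (phi : chart R n T) (f : T -> W) (p : T)
    (X : 'rV[R]_n) : W :=
  'd (f \o chart_inv phi) (phi p) X.

(* The coordinate vector field d/dx^i of the chart [phi], applied to [f]. *)
Definition pderiv (R : realType) (n : nat) (T : topologicalType)
    (W : normedModType R) (phi : chart R n T) (i : 'I_n) (f : T -> W)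
    (p : T) : W :=
  'D_(delta_mx 0 i : 'rV[R]_n) (f \o chart_inv phi) (phi p).

Definition immersion (R : realType) (n m : nat) (M : manifold R n)
    (f : M -> 'rV[R]_m) : Prop :=
  smooth_map f /\
  forall phi p, atlas phi -> chart_dom phi p ->
    injective (differential phi f p).

(** * Riemannian metrics *)

Definition bilin (R : realType) (n : nat) (G : 'M[R]_n) (X Y : 'rV[R]_n) : R :=
  (X *m G *m Y^T) 0 0.

(* [metric_mx phi p] is the matrix (g_ij(p)) in the chart [phi]; it is relevant
   only for [phi] in the atlas and [p] in the domain of [phi]. *)
Record metric (R : realType) (n : nat) (M : manifold R n) := Metric {
  metric_mx :> chart R n M -> M -> 'M[R]_n ;
  metric_smooth : forall phi, atlas phi ->
    smooth_on (chart_cod phi) (metric_mx phi \o chart_inv phi) ;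
  metric_sym : forall phi p, atlas phi -> chart_dom phi p ->
    (metric_mx phi p)^T = metric_mx phi p ;
  metric_pos : forall phi p X, atlas phi -> chart_dom phi p -> X != 0 ->
    0 < bilin (metric_mx phi p) X X ;
  metric_change : forall phi psi p X Y, atlas phi -> atlas psi ->
    chart_dom phi p -> chart_dom psi p ->
    bilin (metric_mx phi p) X Y =
    bilin (metric_mx psi p) (differential phi psi p X)
                            (differential phi psi p Y)
}.

(* The Christoffel symbol Gamma^k_ij in the chart [phi] of the Levi-Civita
   connection of the metric with coefficients [G] in this chart. *)
Definition christoffel (R : realType) (n : nat) (T : topologicalType)
    (phi : chart R n T) (G : T -> 'M[R]_n) (k i j : 'I_n) (p : T) : R :=
  2^-1 * \sum_(l < n) invmx (G p) k l *
    (pderiv phi i (fun q => G q j l : R^o) p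
     + pderiv phi j (fun q => G q i l : R^o) p
     - pderiv phi l (fun q => G q i j : R^o) p).

(* (nabla^2 f)(d/dx^i, d/dx^j) *)
Definition hessian (R : realType) (n : nat) (T : topologicalType)
    (W : normedModType R) (phi : chart R n T) (G : T -> 'M[R]_n)
    (f : T -> W) (i j : 'I_n) (p : T) : W :=
  pderiv phi i (pderiv phi j f) p
  - \sum_(k < n) christoffel phi G k i j p *: pderiv phi k f p.

(* Delta = - trace nabla^2. The value at [p] is computed in [chart_at p]; for
   smooth [f] it does not depend on the chart. *)
Definition laplacian (R : realType) (n : nat) (M : manifold R n)
    (W : normedModType R) (g : metric M) (f : M -> W) (p : M) : W :=
  let phi := chart_at p in
  - \sum_(i < n) \sum_(j < n)
      invmx (g phi p) i j *: hessian phi (g phi) f i j p.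

(** * Submanifolds of Euclidean space *)

Definition isometric_immersion (R : realType) (n m : nat) (M : manifold R n)
    (g : metric M) (x : M -> 'rV[R]_m) : Prop :=
  immersion x /\
  forall phi p X Y, atlas phi -> chart_dom phi p ->
    dotv (differential phi x p X) (differential phi x p Y) =
    bilin (g phi p) X Y.

Definition induced_metric (R : realType) (n m : nat) (T : topologicalType)
    (phi : chart R n T) (f : T -> 'rV[R]_m) (p : T) : 'M[R]_n :=
  \matrix_(i, j) dotv (pderiv phi i f p) (pderiv phi j f p).

(* The component of [w] orthogonal to the tangent space of [f] at [p]. *)
Definition normal_part (R : realType) (n m : nat) (T : topologicalType)
    (phi : chart R n T) (f : T -> 'rV[R]_m) (p : T) (w : 'rV[R]_m)
    : 'rV[R]_m :=
  w - \sum_(k < n) \sum_(l < n)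
        (invmx (induced_metric phi f p) k l * dotv w (pderiv phi k f p))
          *: pderiv phi l f p.

(* h(d/dx^i, d/dx^j) *)
Definition second_fundamental_form (R : realType) (n m : nat)
    (T : topologicalType) (phi : chart R n T) (f : T -> 'rV[R]_m)
    (i j : 'I_n) (p : T) : 'rV[R]_m :=
  normal_part phi f p (pderiv phi i (pderiv phi j f) p).

(* H = (1/n) trace h, the trace being taken for the metric induced by [f];
   for an immersion the value does not depend on the chart. *)
Definition mean_curvature (R : realType) (n m : nat) (M : manifold R n)
    (f : M -> 'rV[R]_m) (p : M) : 'rV[R]_m :=
  let phi := chart_at p in
  n%:R^-1 *: \sum_(i < n) \sum_(j < n)
    invmx (induced_metric phi f p) i j *: second_fundamental_form phi f i j p.

Definition minimal_immersion (R : realType) (n m : nat) (M : manifold R n)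
    (f : M -> 'rV[R]_m) : Prop :=
  immersion f /\ forall p, mean_curvature f p = 0.

(** * The Laplace map *)

Definition laplace_map (R : realType) (n m : nat) (M : manifold R n)
    (g : metric M) (x : M -> 'rV[R]_m) : M -> 'rV[R]_m :=
  laplacian g x.

Definition conformal (R : realType) (n m : nat) (M : manifold R n)
    (g : metric M) (f : M -> 'rV[R]_m) : Prop :=
  exists2 rho : M -> R, (forall p, 0 < rho p) &
    forall phi p X Y, atlas phi -> chart_dom phi p ->
      dotv (differential phi f p X) (differential phi f p Y) =
      rho p ^+ 2 * bilin (g phi p) X Y.

Definition biharmonic (R : realType) (n m : nat) (M : manifold R n)
    (g : metric M) (x : M -> 'rV[R]_m) : Prop :=
  forall p, laplacian g (laplacian g x) p = 0.

(* Main.v *)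
(** Idea. The Laplace operator of the metric [g] and the second fundamental form
    of [f] are compared in one chart. If [f] induces [lam g] in dimension 2, then
    the g-trace of the Hessian of [f] is the g-trace of its second fundamental
    form: the tangential part of the former is a trace of Christoffel symbols,
    and conformal changes do not affect this trace in dimension 2. Hence
    [Delta f] is a nowhere zero multiple of the mean curvature vector of [f];
    for [f = L] this is the theorem.
    Since the Laplacian at a point is computed in a chart chosen at that point,
    the smoothness of [L] is not immediate. For [f = x] and [lam = 1] the same
    identity shows that [L] is minus a trace of second fundamental forms, which
    does not depend on the chart. *)

Require Import Defs.
From mathcomp Require Import all_boot all_order all_algebra.
From mathcomp Require Import all_classical all_reals topology normedtype derive.
From mathcomp Require Import landau ring lra.

Set Implicit Arguments.
Unset Strict Implicit.
Unset Printing Implicit Defensive.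

Import Order.TTheory GRing.Theory Num.Theory.
Import numFieldNormedType.Exports.

Local Open Scope classical_set_scope.
Local Open Scope ring_scope.

(** * Calculus of C^k maps *)

(** Differentiability depends only on the germ: the first-order expansion of [f] at [a] is also one
    of [g], and [diff_unique] identifies its linear part with the differential of [g]. *)
Lemma near_eq_differentiable (R : numFieldType) (V W : normedModType R)
    (f g : V -> W) (a : V) :
  {near a, f =1 g} -> differentiable f a -> differentiable g a.
Proof.
move=> fg /diff_locallyP[cf ef].
have eg : g \o shift a = cst (g a) + 'd f a +o_ 0 id.
  apply/eqaddoP => e e0; move/eqaddoP : ef => /(_ e e0).
  have fg0 : \forall h \near (0 : V), f (h + a) = g (h + a).
    have := fg; rewrite [X in X -> _](near_shift 0 a) => fg0.
    by apply: filterS fg0 => h /=; rewrite subr0.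
  apply: filterS2 fg0 => h fgh.
  by rewrite /= !fctE -(nbhs_singleton fg) -fgh.
apply/diff_locallyP.
by rewrite (diff_unique cf eg).
Unshelve. all: by end_near. Qed.

Section Smoothness.
Context {R : realType} {n : nat}.
Implicit Types (U : set 'rV[R]_n) (k : nat).

(** As [U] is open, agreement on [U] is agreement near each of its points, so it passes to
    directional derivatives. This allows a derivative to be replaced by a formula valid only on
    [U]. *)
Lemma Ck_on_ext (W : normedModType R) k U (f g : 'rV[R]_n -> W) :
  open U -> {in U, f =1 g} -> Ck_on k U f -> Ck_on k U g.
Proof.
move=> oU; elim: k f g => [|k IH] f g fg /=.
  move=> cf u Uu; have fgu : {near u, f =1 g}.
    by apply: filterS (open_nbhs_nbhs (conj oU Uu)) => v Uv; apply/fg/mem_set.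
  rewrite /prop_for /continuous_at -(fg u (mem_set Uu)).
  exact: cvg_trans (near_eq_cvg fgu) (cf u Uu).
move=> [df Df]; have fgu u : U u -> {near u, f =1 g}.
  move=> Uu; apply: filterS (open_nbhs_nbhs (conj oU Uu)) => v Uv.
  exact/fg/mem_set.
split=> [u Uu|v]; first exact: near_eq_differentiable (fgu u Uu) (df u Uu).
apply: IH (Df v) => u /set_mem Uu; exact: near_eq_derive (fgu u Uu).
Qed.

Lemma Ck_onW (W : normedModType R) k U (f : 'rV[R]_n -> W) :
  Ck_on k.+1 U f -> Ck_on k U f.
Proof.
elim: k f => [|k IH] f; first by move=> [df _] u /df /differentiable_continuous.
by move=> [df Df]; split=> // v; apply: IH; apply: Df.
Qed.

Lemma Ck_on_cst (W : normedModType R) k U (w : W) :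
  Ck_on k U (fun=> w).
Proof.
elim: k w => [|k IH] w /=; first by move=> u _; exact: cst_continuous.
split=> [u _|v]; first exact: differentiable_cst.
have -> : 'D_v (fun=> w) = (fun=> 0) by apply/funext => u; exact: derive_cst.
exact: IH.
Qed.

Lemma Ck_onD (W : normedModType R) k U (f g : 'rV[R]_n -> W) : open U ->
  Ck_on k U f -> Ck_on k U g -> Ck_on k U (fun u => f u + g u).
Proof.
move=> oU; elim: k f g => [|k IH] f g /=.
  by move=> cf cg u Uu; exact: cvgD (cf u Uu) (cg u Uu).
move=> [df Df] [dg Dg]; split=> [u Uu|v].
  by apply: differentiableD; [exact: df|exact: dg].
apply: Ck_on_ext (IH _ _ (Df v) (Dg v)) => // u /set_mem Uu.
by symmetry; apply: deriveD; apply: diff_derivable; [exact: df|exact: dg].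
Qed.

Lemma Ck_onM k U (f g : 'rV[R]_n -> R) : open U ->
  Ck_on k U f -> Ck_on k U g -> Ck_on k U (fun u => f u * g u).
Proof.
move=> oU; elim: k f g => [|k IH] f g.
  by move=> cf cg u Uu; exact: cvgM (cf u Uu) (cg u Uu).
move=> Cf Cg; have [[df Df] [dg Dg]] := (Cf, Cg); split=> [u Uu|v].
  by apply: differentiableM; [exact: df|exact: dg].
apply: Ck_on_ext (Ck_onD oU (IH _ _ (Ck_onW Cf) (Dg v))
  (IH _ _ (Ck_onW Cg) (Df v))) => // u /set_mem Uu.
by symmetry; apply: deriveM; apply: diff_derivable; [exact: df|exact: dg].
Qed.

Lemma Ck_onV k U (f : 'rV[R]_n -> R) : open U ->
  (forall u, U u -> f u != 0) -> Ck_on k U f -> Ck_on k U (fun u => (f u)^-1).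
Proof.
move=> oU f0; elim: k => [|k IH].
  by move=> cf u Uu; exact: cvgV (f0 u Uu) (cf u Uu).
move=> Cf; have [df Df] := Cf; split=> [u Uu|v].
  by apply: differentiableV; [exact: df|exact: f0].
(* The derivative of [1/f] is [- (1/f)^2 * 'D_v f], so regularity of order [k] of [1/f] itself gives
   order [k.+1]. *)
have CV := IH (Ck_onW Cf).
apply: Ck_on_ext (Ck_onM oU (Ck_onM oU (Ck_on_cst k U (-1 : R)) (Ck_onM oU CV CV))
  (Df v)) => // u /set_mem Uu.
rewrite deriveV ?f0//; last exact: diff_derivable (df u Uu).
by rewrite /GRing.scale/= mulN1r expr2 invfM.
Qed.

Lemma Ck_on_sum (W : normedModType R) k U (I : Type) (r : seq I)
    (F : I -> 'rV[R]_n -> W) : open U -> (forall i, Ck_on k U (F i)) ->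
  Ck_on k U (fun u => \sum_(i <- r) F i u).
Proof.
move=> oU CF; elim: r => [|i r IH].
  by under eq_fun do rewrite big_nil; exact: Ck_on_cst.
by under eq_fun do rewrite big_cons; exact: Ck_onD.
Qed.

Lemma differentiable_rowP {V : normedModType R} {m : nat} (F : V -> 'rV[R]_m) u :
  differentiable F u <-> forall j, differentiable (fun v => F v 0 j) u.
Proof.
split=> [dF j|dF].
  exact: (@differentiable_comp _ _ _ _ F (fun N : 'rV[R]_m => N 0 j : R) u dF
    (differentiable_coord (F u) 0 j)).
have -> : F = \sum_(j < m) (fun v => F v 0 j *: delta_mx 0 j).
  by apply/funext => v; rewrite fct_sumE; exact: row_sum_delta.
by apply: differentiable_sum => j; apply: differentiableZl.
Qed.

Lemma derive_row {V : normedModType R} {m : nat} (F : V -> 'rV[R]_m) u v j :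
  differentiable F u -> ('D_v F u) 0 j = 'D_v (fun u => F u 0 j) u.
Proof. by move=> /(@diff_derivable _ _ _ _ _ v) dF; rewrite derive_mx// mxE. Qed.

Lemma Ck_on_rowP {m : nat} k U (F : 'rV[R]_n -> 'rV[R]_m) : open U ->
  Ck_on k U F <-> forall j, Ck_on k U (fun u => F u 0 j).
Proof.
move=> oU; elim: k F => [|k IH] F /=.
  split=> [cF j u Uu|cF u Uu].
    exact: (@continuous_comp _ _ _ F (fun N : 'rV[R]_m => N 0 j : R) u (cF u Uu)
      (@coord_continuous R 1 m 0 j (F u))).
  have -> : F = \sum_(j < m) (fun v => F v 0 j *: delta_mx 0 j).
    by apply/funext => v; rewrite fct_sumE; exact: row_sum_delta.
  apply: (big_ind (fun f => {for u, continuous f})).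
  - exact: (@cst_continuous _ _ (0 : 'rV[R]_m)).
  - move=> f g cf cg; exact: cvgD cf cg.
  - move=> j _; exact: cvgZr_tmp (cF j u Uu).
split=> [[dF DF] j|H].
  split=> [u /dF/differentiable_rowP//|v].
  apply: Ck_on_ext ((IH _).1 (DF v) j) => // u /set_mem Uu.
  by rewrite derive_row//; exact: dF.
have dF u : U u -> differentiable F u.
  by move=> Uu; apply/differentiable_rowP => j; exact: (H j).1.
split=> // v; apply/IH => j.
apply: Ck_on_ext ((H j).2 v) => // u /set_mem Uu.
by rewrite derive_row//; exact: dF.
Qed.

End Smoothness.

(** * Symmetry of second derivatives *)

Section SecondDerivatives.
Context {R : realType}.

Lemma is_derive_line {V : normedModType R} (f : V -> R) (v c : V) (s : R) :
  derivable f (s *: v + c) v ->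
  is_derive s 1 (fun r : R => f (r *: v + c)) ('D_v f (s *: v + c)).
Proof.
move=> df; have E : (fun h : R => h^-1 *:
      (((fun r : R => f (r *: v + c)) \o shift s) (h *: (1 : R))
        - f (s *: v + c))) =
    (fun h => h^-1 *: ((f \o shift (s *: v + c)) (h *: v) - f (s *: v + c))).
  apply/funext => h /=; congr (_ *: (f _ - _)).
  by rewrite scalerDl addrA [h *: (1 : R)]mulr1.
by split; rewrite /derivable /derive E.
Qed.

(** Two uses of the mean value theorem: along [v] for the difference of [f] between two parallel
    lines, then along [w] for ['D_v f]. *)
Lemma second_difference_mean_value {V : normedModType R} (f : V -> R)
    (u v w : V) (h : R) : 0 < h ->
  (forall s t, 0 <= s <= h -> 0 <= t <= h ->
    differentiable f (s *: v + (t *: w + u)) /\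
    differentiable ('D_v f) (s *: v + (t *: w + u))) ->
  exists s t, [/\ 0 <= s <= h, 0 <= t <= h &
    f (h *: v + (h *: w + u)) - f (h *: v + u) - f (h *: w + u) + f u =
    h * h * 'D_w ('D_v f) (s *: v + (t *: w + u))].
Proof.
move=> h0 df; have hh : 0 <= h <= h by rewrite lexx ltW.
have zh : (0 : R) <= 0 <= h by rewrite lexx ltW.
(* The second difference is [phi h - phi 0]; the term [0 *: w] brings both summands to the form
   covered by [df]. *)
pose phi (r : R) := f (r *: v + (h *: w + u)) - f (r *: v + (0 *: w + u)).
have dphi (r : R) : 0 <= r <= h -> is_derive r 1 phi
    ('D_v f (r *: v + (h *: w + u)) - 'D_v f (r *: v + (0 *: w + u))).
  move=> r0h; apply: is_deriveB; apply: is_derive_line; apply: diff_derivable.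
    exact: (df _ _ r0h hh).1.
  exact: (df _ _ r0h zh).1.
have itvP (a : R) : a \in `]0, h[ -> 0 <= a <= h.
  by rewrite in_itv/= => /andP[/ltW-> /ltW->].
have itvP' (a : R) : a \in `[0, h] -> 0 <= a <= h by rewrite in_itv.
have [s /itvP s0h Hs] := MVT h0 (fun r r0h => dphi r (itvP r r0h))
  (derivable_within_continuous (fun r r0h =>
    @ex_derive _ _ _ _ _ _ _ (dphi r (itvP' r r0h)))).
pose psi (r : R) := 'D_v f (r *: w + (s *: v + u)).
have dpsi (r : R) : 0 <= r <= h ->
    is_derive r 1 psi ('D_w ('D_v f) (r *: w + (s *: v + u))).
  move=> r0h; apply: is_derive_line; apply: diff_derivable.
  by rewrite addrCA; exact: (df _ _ s0h r0h).2.
have [t /itvP t0h Ht] := MVT h0 (fun r r0h => dpsi r (itvP r r0h))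
  (derivable_within_continuous (fun r r0h =>
    @ex_derive _ _ _ _ _ _ _ (dpsi r (itvP' r r0h)))).
exists s, t; split => //.
move: Hs Ht; rewrite /phi /psi !subr0 !scale0r !add0r.
rewrite !(addrCA (_ *: w) (s *: v)) => Hs Ht.
rewrite Ht in Hs; lra.
Qed.

(** Schwarz's theorem. The second difference is symmetric in [v] and [w], so each mixed derivative
    takes the same value at some point arbitrarily close to [u]; continuity then excludes a gap at
    [u]. *)
Lemma derive_comm {V : normedModType R} (f : V -> R) (u v w : V) :
  (\forall z \near u, [/\ differentiable f z, differentiable ('D_v f) z &
     differentiable ('D_w f) z]) ->
  {for u, continuous ('D_w ('D_v f))} -> {for u, continuous ('D_v ('D_w f))} ->
  'D_w ('D_v f) u = 'D_v ('D_w f) u.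
Proof.
move=> df cvw cwv; apply/eqP; rewrite -subr_eq0; apply/negPn/negP => ne.
set d := _ - _ in ne; pose e := `|d| / 2.
have e0 : 0 < e by rewrite divr_gt0 ?normr_gt0.
move/cvgrPdist_lt/(_ e e0) : cvw => cvw.
move/cvgrPdist_lt/(_ e e0) : cwv => cwv.
have [r /= r0 Hr] := (nbhs_ballP _ _).1 (filterI df (filterI cvw cwv)).
(* Chosen so that the parallelogram at [u] with sides [h *: v] and [h *: w] lies in the ball of
   radius [r]; the summand 1 keeps the denominator positive when [v] and [w] vanish. *)
pose h := r / (1 + `|v| + `|w|) / 2.
have D0 : 0 < 1 + `|v| + `|w| by rewrite -addrA ltr_wpDr ?addr_ge0.
have h0 : 0 < h by rewrite !divr_gt0.
have inr s t : 0 <= s <= h -> 0 <= t <= h -> ball u r (s *: v + (t *: w + u)).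
  move=> /andP[s0 sh] /andP[t0 th].
  rewrite -ball_normE /= addrA opprD addrCA subrr addr0 normrN.
  apply: le_lt_trans (ler_normD _ _) _; rewrite !normrZ !ger0_norm//.
  apply: (@le_lt_trans _ _ (h * (1 + `|v| + `|w|))); last first.
    rewrite /h mulrAC divfK ?gt_eqF// ltr_pdivrMr// ltr_pMr// ltr1n.
    by [].
  rewrite !mulrDr mulr1 lerD//; last exact: ler_wpM2r.
  by apply: ler_wpDl; [exact: ltW|exact: ler_wpM2r].
have [s [t [s0h t0h E1]]] : exists s t, [/\ 0 <= s <= h, 0 <= t <= h &
    f (h *: v + (h *: w + u)) - f (h *: v + u) - f (h *: w + u) + f u =
    h * h * 'D_w ('D_v f) (s *: v + (t *: w + u))].
  apply: second_difference_mean_value => // s t s0 t0.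
  by have [[]] := Hr _ (inr _ _ s0 t0).
have [t' [s' [t0h' s0h' E2]]] : exists s t, [/\ 0 <= s <= h, 0 <= t <= h &
    f (h *: w + (h *: v + u)) - f (h *: w + u) - f (h *: v + u) + f u =
    h * h * 'D_v ('D_w f) (s *: w + (t *: v + u))].
  apply: second_difference_mean_value => // t' s' t0 s0.
  by rewrite addrCA; have [[]] := Hr _ (inr _ _ s0 t0).
have E : 'D_w ('D_v f) (s *: v + (t *: w + u)) =
         'D_v ('D_w f) (s' *: v + (t' *: w + u)).
  rewrite (addrCA (t' *: w) (s' *: v) u) (addrCA (h *: w) (h *: v) u) in E2.
  apply: (mulfI (mulf_neq0 (lt0r_neq0 h0) (lt0r_neq0 h0))).
  apply: (etrans (esym E1)); apply: (etrans _ E2).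
  by congr (_ + _); exact: addrAC.
have [_ [H1 _]] := Hr _ (inr _ _ s0h t0h).
have [_ [_ H2]] := Hr _ (inr _ _ s0h' t0h').
rewrite /= E in H1; move: H2 => /= H2.
have : `|d| < e + e.
  apply: le_lt_trans (ltrD H1 H2).
  rewrite [X in _ <= _ + X]distrC; apply: le_trans (ler_normD _ _).
  by rewrite addrA subrK.
by rewrite -splitr ltxx.
Qed.

End SecondDerivatives.

(** * Inner products, inverse matrices and chain rules in coordinates *)

Section EuclideanMaps.
Context {R : realType}.

Lemma dotvE {m} (u v : 'rV[R]_m) : dotv u v = (u *m v^T) 0 0.
Proof. by rewrite mxE; apply: eq_bigr => k _; rewrite mxE. Qed.

Lemma dotvC {m} (u v : 'rV[R]_m) : dotv u v = dotv v u.
Proof. by apply: eq_bigr => k _; rewrite mulrC. Qed.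

Lemma dotv_eq0 {m} (u : 'rV[R]_m) : dotv u u = 0 -> u = 0.
Proof.
move=> /eqP; rewrite psumr_eq0; last by move=> k _; rewrite -expr2 sqr_ge0.
move=> /allP u0; apply/rowP => k; rewrite mxE; apply/eqP.
by have := u0 k (mem_index_enum k); rewrite /= -expr2 sqrf_eq0.
Qed.

Lemma Ck_on_dotv {n m} k (U : set 'rV[R]_n) (F G : 'rV[R]_n -> 'rV[R]_m) :
  open U -> Ck_on k U F -> Ck_on k U G ->
  Ck_on k U (fun u => dotv (F u) (G u)).
Proof.
move=> oU /(Ck_on_rowP _ _ oU) CF /(Ck_on_rowP _ _ oU) CG.
by apply: Ck_on_sum => // j; exact: Ck_onM.
Qed.

Lemma Ck_onZ {n m} k (U : set 'rV[R]_n) (a : 'rV[R]_n -> R)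
    (F : 'rV[R]_n -> 'rV[R]_m) :
  open U -> Ck_on k U a -> Ck_on k U F -> Ck_on k U (fun u => a u *: F u).
Proof.
move=> oU Ca /(Ck_on_rowP _ _ oU) CF; apply/Ck_on_rowP => // j.
by under eq_fun do rewrite mxE; exact: Ck_onM.
Qed.

Lemma Ck_onB {n m} k (U : set 'rV[R]_n) (F G : 'rV[R]_n -> 'rV[R]_m) :
  open U -> Ck_on k U F -> Ck_on k U G -> Ck_on k U (fun u => F u - G u).
Proof.
move=> oU CF CG; have -> : (fun u => F u - G u) = (fun u => F u + -1 *: G u).
  by apply/funext => u; rewrite scaleN1r.
by apply: Ck_onD => //; apply: Ck_onZ => //; exact: Ck_on_cst.
Qed.

Lemma Ck_on_prod {n} k (U : set 'rV[R]_n) (I : Type) (r : seq I)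
    (F : I -> 'rV[R]_n -> R) : open U -> (forall i, Ck_on k U (F i)) ->
  Ck_on k U (fun u => \prod_(i <- r) F i u).
Proof.
move=> oU CF; elim: r => [|i r IH].
  by under eq_fun do rewrite big_nil; exact: Ck_on_cst.
by under eq_fun do rewrite big_cons; exact: Ck_onM.
Qed.

Lemma Ck_on_det {n q} k (U : set 'rV[R]_n) (A : 'rV[R]_n -> 'M[R]_q) :
  open U -> (forall i j, Ck_on k U (fun u => A u i j)) ->
  Ck_on k U (fun u => \det (A u)).
Proof.
move=> oU CA; apply: Ck_on_sum => // s; apply: Ck_onM => //.
  exact: Ck_on_cst.
exact: Ck_on_prod.
Qed.

(** Cramer's rule: the entries of the inverse are cofactors divided by a nonvanishing
    determinant. *)
Lemma Ck_on_invmx {n q} k (U : set 'rV[R]_n) (A : 'rV[R]_n -> 'M[R]_q) i j :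
  open U -> (forall u, U u -> A u \in unitmx) ->
  (forall i j, Ck_on k U (fun u => A u i j)) ->
  Ck_on k U (fun u => invmx (A u) i j).
Proof.
move=> oU uA CA; have CdV : Ck_on k U (fun u => (\det (A u))^-1).
  apply: Ck_onV => //; last exact: Ck_on_det.
  by move=> u /uA; rewrite unitmxE unitfE.
have Cadj : Ck_on k U (fun u => \adj (A u) i j).
  under eq_fun do rewrite mxE /cofactor.
  apply: Ck_onM => //; first exact: Ck_on_cst.
  by apply: Ck_on_det => // a b; under eq_fun do rewrite !mxE.
apply: Ck_on_ext (Ck_onM oU CdV Cadj) => // u /set_mem /uA.
rewrite /invmx => ->.
by rewrite [RHS]mxE.
Qed.

Lemma derive_dotv {V : normedModType R} {m} (F G : V -> 'rV[R]_m) u v :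
  differentiable F u -> differentiable G u ->
  'D_v (fun u => dotv (F u) (G u)) u =
  dotv ('D_v F u) (G u) + dotv (F u) ('D_v G u).
Proof.
move=> dF dG; have dFj j : derivable (fun u => F u 0 j) u v.
  exact: diff_derivable ((differentiable_rowP F u).1 dF j).
have dGj j : derivable (fun u => G u 0 j) u v.
  exact: diff_derivable ((differentiable_rowP G u).1 dG j).
have -> : (fun u => dotv (F u) (G u)) =
    \sum_(j < m) ((fun u => F u 0 j) * (fun u => G u 0 j)).
  by apply/funext => w; rewrite fct_sumE; apply: eq_bigr.
rewrite derive_sum => [|j]; last exact: derivableM.
rewrite /dotv -big_split; apply: eq_bigr => j _ /=.
rewrite (deriveM (dFj j) (dGj j)) (derive_row v j dF) (derive_row v j dG) addrC.
by congr (_ + _); exact: mulrC.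
Qed.

Lemma derive_scale {V : normedModType R} {m} (a : V -> R) (F : V -> 'rV[R]_m) u v :
  differentiable a u -> differentiable F u ->
  'D_v (fun u => a u *: F u) u = 'D_v a u *: F u + a u *: 'D_v F u.
Proof.
move=> da dF; have dFj j := (differentiable_rowP F u).1 dF j.
have daF : differentiable (fun u => a u *: F u) u.
  apply/differentiable_rowP => j; under eq_fun do rewrite mxE.
  exact: differentiableM.
apply/rowP => j; rewrite derive_row// !mxE; under eq_fun do rewrite mxE.
rewrite deriveM; [|exact: diff_derivable..]; rewrite (derive_row v j dF).
by rewrite addrC; congr (_ + _); exact: mulrC.
Qed.

Lemma diff_row_sum {n} {W : normedModType R} (F : 'rV[R]_n -> W) u v :
  'd F u v = \sum_a v 0 a *: 'd F u (delta_mx 0 a).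
Proof.
rewrite {1}(row_sum_delta v) linear_sum; apply: eq_bigr => a _; exact: linearZ.
Qed.

Lemma derive_comp_row {V W : normedModType R} {n} (Y : 'rV[R]_n -> W)
    (tau : V -> 'rV[R]_n) u v :
  differentiable tau u -> differentiable Y (tau u) ->
  'D_v (Y \o tau) u =
  \sum_a ('D_v tau u) 0 a *: 'D_(delta_mx 0 a : 'rV[R]_n) Y (tau u).
Proof.
move=> dt dY; rewrite !deriveE//; last exact: differentiable_comp.
rewrite diff_comp//= diff_row_sum; apply: eq_bigr => a _.
by rewrite [in RHS]deriveE.
Qed.

(** Second-order chain rule, split for the change of charts: the second derivatives of [tau]
    multiply only first derivatives of [Y], and the other term is quadratic in the first derivatives
    of [tau]. *)
Lemma derive2_comp_row {V : normedModType R} {n m} (Y : 'rV[R]_n -> 'rV[R]_m)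
    (tau : V -> 'rV[R]_n) u v w :
  (\forall z \near u, differentiable tau z /\ differentiable Y (tau z)) ->
  differentiable ('D_v tau) u ->
  (forall a, differentiable ('D_(delta_mx 0 a : 'rV[R]_n) Y) (tau u)) ->
  'D_w ('D_v (Y \o tau)) u =
  \sum_a (('D_w ('D_v tau) u) 0 a *: 'D_(delta_mx 0 a : 'rV[R]_n) Y (tau u)
    + ('D_v tau u) 0 a *:
      \sum_b ('D_w tau u) 0 b *: 'D_(delta_mx 0 b : 'rV[R]_n)
        ('D_(delta_mx 0 a : 'rV[R]_n) Y) (tau u)).
Proof.
move=> dtY ddt ddY; have [dt dY] := nbhs_singleton dtY.
rewrite (@near_eq_derive _ _ _ _ (\sum_a (fun z => ('D_v tau z) 0 a *:
    ('D_(delta_mx 0 a : 'rV[R]_n) Y \o tau) z))); last first.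
  apply: filterS dtY => z [dtz dYz]; rewrite fct_sumE.
  exact: derive_comp_row.
have ddta a := (differentiable_rowP _ _).1 ddt a.
have dYt a : differentiable ('D_(delta_mx 0 a : 'rV[R]_n) Y \o tau) u.
  by apply: differentiable_comp.
rewrite derive_sum => [|a]; last first.
  apply: diff_derivable; apply/differentiable_rowP => j.
  under eq_fun do rewrite mxE.
  by apply: differentiableM => //; exact: ((differentiable_rowP _ _).1 (dYt a) j).
apply: eq_bigr => a _; rewrite derive_scale//.
by rewrite -derive_row// derive_comp_row.
Qed.

Lemma derive_comm_row {n m} (U : set 'rV[R]_n) (F : 'rV[R]_n -> 'rV[R]_m) u v w :
  open U -> Ck_on 2 U F -> U u -> 'D_w ('D_v F) u = 'D_v ('D_w F) u.
Proof.
move=> oU CF Uu; have nU : \forall z \near u, U z by exact: open_nbhs_nbhs.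
have H v1 v2 j : ('D_v1 ('D_v2 F) u) 0 j = 'D_v1 ('D_v2 (fun u => F u 0 j)) u.
  rewrite derive_row; last exact: (CF.2 v2).1.
  apply: near_eq_derive; apply: filterS nU => z Uz; rewrite derive_row//.
  exact: CF.1.
apply/rowP => j; apply: (etrans (H w v j)); apply: (etrans _ (esym (H v w j))).
have [dFj DFj] := (Ck_on_rowP _ _ oU).1 CF j.
apply: derive_comm.
- apply: filterS nU => z Uz.
  by split; [exact: dFj|exact: (DFj v).1|exact: (DFj w).1].
- exact: (DFj v).2.
- exact: (DFj w).2.
Qed.

End EuclideanMaps.

(** * Second fundamental form and change of charts *)

Section GramMatrices.
Context {R : realType} {n m : nat}.
Implicit Types (E : 'M[R]_(n, m)) (G J : 'M[R]_n).

(** If [v *m E *m E^T] vanishes, so does the squared length of [v *m E]. *)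
Lemma gram_unitmx E :
  (forall v : 'rV[R]_n, v *m E = 0 -> v = 0) -> E *m E^T \in unitmx.
Proof.
move=> Einj; rewrite -row_free_unit; apply: inj_row_free => v.
rewrite mulmxA => vEE; apply: Einj; apply: dotv_eq0.
by rewrite dotvE trmx_mul mulmxA vEE mul0mx mxE.
Qed.

(** The transformation law of an inverse metric under a change of basis [J]. *)
Lemma invmx_congruence G J : G \in unitmx -> J \in unitmx ->
  J^T *m invmx (J *m G *m J^T) *m J = invmx G.
Proof.
move=> uG uJ; have uJT : J^T \in unitmx by rewrite unitmx_tr.
have uG' : J *m G *m J^T \in unitmx by rewrite !unitmx_mul uJ uG.
(* The last factor [J] is expanded as [(J *m G *m J^T) *m invmx J^T *m invmx G], so that the inverse
   meets its matrix. *)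
have -> : J^T *m invmx (J *m G *m J^T) *m J =
    J^T *m (invmx (J *m G *m J^T) *m (J *m G *m J^T)) *m invmx J^T *m invmx G.
  by rewrite -!mulmxA mulKVmx// mulmxV// mulmx1.
by rewrite mulVmx// mulmx1 mulmxV// mul1mx.
Qed.

(** For independent rows of [E], this is the orthogonal projection onto the complement of the row
    space, acting on row vectors from the right. *)
Definition normal_proj E : 'M[R]_m := 1%:M - E^T *m invmx (E *m E^T) *m E.

Lemma normal_proj_tangent E : E *m E^T \in unitmx -> E *m normal_proj E = 0.
Proof.
by move=> uG; rewrite mulmxBr mulmx1 !mulmxA mulmxV// mul1mx subrr.
Qed.

Lemma gram_mull J E : J *m E *m (J *m E)^T = J *m (E *m E^T) *m J^T.
Proof. by rewrite trmx_mul !mulmxA. Qed.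

Lemma normal_proj_mull J E :
  E *m E^T \in unitmx -> J \in unitmx -> normal_proj (J *m E) = normal_proj E.
Proof.
move=> uG uJ; rewrite /normal_proj gram_mull trmx_mul -(invmx_congruence uG uJ).
by rewrite !mulmxA.
Qed.

(** The algebra behind chart independence of the traced second fundamental form: [c] stands for the
    tangential error of a change of charts, which [Q] kills, and the factors [J] on the two indices
    are absorbed by the inverse metric. *)
Lemma trace_normal_proj_mull J E (c B B' : 'I_n -> 'I_n -> 'rV[R]_m)
    (Q := normal_proj E) :
  E *m E^T \in unitmx -> J \in unitmx ->
  (forall i j, c i j *m Q = 0) ->
  (forall i j, B' i j =
    c i j + \sum_a J j a *: \sum_b J i b *: B b a) ->
  \sum_i \sum_j invmx (J *m E *m (J *m E)^T) i j *:
    (B' i j *m normal_proj (J *m E)) =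
  \sum_b \sum_a invmx (E *m E^T) b a *: (B b a *m Q).
Proof.
move=> uG uJ cQ B'E; rewrite normal_proj_mull// -/Q gram_mull.
set H := invmx (J *m _ *m _).
transitivity (\sum_i \sum_j \sum_a \sum_b
    (J i b * H i j * J j a) *: (B b a *m Q)).
  apply: eq_bigr => i _; apply: eq_bigr => j _.
  rewrite B'E mulmxDl cQ add0r mulmx_suml scaler_sumr; apply: eq_bigr => a _.
  rewrite -scalemxAl mulmx_suml scalerA scaler_sumr; apply: eq_bigr => b _.
  by rewrite -scalemxAl scalerA mulrC mulrA.
(* The sums over [b] and [a] are moved outside; the inner sums over [i] and [j] then form the
   entries of [J^T *m H *m J]. *)
under eq_bigr => i _ do rewrite exchange_big/=.
rewrite exchange_big/=.
under eq_bigr => a _ do (under eq_bigr => j _ do rewrite exchange_big/=).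
under eq_bigr => a _ do rewrite exchange_big/=.
rewrite exchange_big/=; apply: eq_bigr => b _; apply: eq_bigr => a _.
rewrite -(invmx_congruence uG uJ) -/H exchange_big/= mxE scaler_suml.
apply: eq_bigr => j _.
rewrite mxE -scaler_suml; congr (_ *: _); rewrite mulr_suml.
by apply: eq_bigr => i _; rewrite mxE.
Qed.

End GramMatrices.

(** * Local coordinates and coordinate derivatives *)

Section Charts.
Context {R : realType} {n : nat}.

Lemma chart_invK {T : topologicalType} (phi : chart R n T) u :
  chart_cod phi u -> phi (chart_inv phi u) = u.
Proof. by case=> q dq <-; rewrite chart_mapK. Qed.

Lemma chart_inv_dom {T : topologicalType} (phi : chart R n T) u :
  chart_cod phi u -> chart_dom phi (chart_inv phi u).
Proof. by case=> q dq <-; rewrite chart_mapK. Qed.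

Lemma chart_cod_map {T : topologicalType} (phi : chart R n T) p :
  chart_dom phi p -> chart_cod phi (phi p).
Proof. by move=> dp; exists p. Qed.

Lemma near_chart_cod {T : topologicalType} (phi : chart R n T) u :
  chart_cod phi u -> \forall z \near u, chart_cod phi z.
Proof. by move=> cu; apply: open_nbhs_nbhs; split=> //; exact: chart_cod_open. Qed.

(** Continuity of [chart_inv phi] pulls the open domain of [psi] back to a neighbourhood of
    [phi p]. *)
Lemma near_chart_overlap {T : topologicalType} (phi psi : chart R n T) p :
  chart_dom phi p -> chart_dom psi p ->
  \forall z \near phi p, (phi @` (chart_dom phi `&` chart_dom psi)) z.
Proof.
move=> dphi dpsi; have cp := chart_cod_map dphi.
have : \forall z \near phi p, chart_dom psi (chart_inv phi z).
  apply: (chart_inv_continuous cp); rewrite chart_mapK//.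
  by apply: open_nbhs_nbhs; split=> //; exact: chart_dom_open.
apply: filterS2 (near_chart_cod cp) => z cz dz.
by exists (chart_inv phi z); [split; first exact: chart_inv_dom|exact: chart_invK].
Qed.

Lemma chart_at_atlas (M : manifold R n) (p : M) : atlas (chart_at p).
Proof. by rewrite /chart_at; case: cid2. Qed.

Lemma chart_at_dom (M : manifold R n) (p : M) : chart_dom (chart_at p) p.
Proof. by rewrite /chart_at; case: cid2. Qed.

Lemma pderiv_inv {W : normedModType R} {T : topologicalType}
    (phi : chart R n T) i (f : T -> W) u : chart_cod phi u ->
  pderiv phi i f (chart_inv phi u) =
  'D_(delta_mx 0 i : 'rV[R]_n) (f \o chart_inv phi) u.
Proof. by move=> cu; rewrite /pderiv chart_invK. Qed.

Lemma pderiv_pderiv {W : normedModType R} {T : topologicalType}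
    (phi : chart R n T) i j (f : T -> W) p : chart_dom phi p ->
  pderiv phi i (pderiv phi j f) p =
  'D_(delta_mx 0 i : 'rV[R]_n) ('D_(delta_mx 0 j : 'rV[R]_n)
    (f \o chart_inv phi)) (phi p).
Proof.
move=> dp; apply: near_eq_derive.
by apply: filterS (near_chart_cod (chart_cod_map dp)) => z; exact: pderiv_inv.
Qed.

End Charts.

(** * Frames of immersions and the trace of the second fundamental form *)

Section Immersions.
Context {R : realType} {n m : nat}.

(** The Jacobian matrix in the row convention: the differential of a smooth map is right
    multiplication by it. *)
Definition frame {T : topologicalType} (phi : chart R n T) (f : T -> 'rV[R]_m)
  (p : T) : 'M[R]_(n, m) := \matrix_(i < n) pderiv phi i f p.

Lemma induced_metricE {T : topologicalType} (phi : chart R n T)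
    (f : T -> 'rV[R]_m) p :
  induced_metric phi f p = frame phi f p *m (frame phi f p)^T.
Proof.
apply/matrixP => i j; rewrite !mxE; apply: eq_bigr => k _.
by rewrite !mxE.
Qed.

Lemma normal_partE {T : topologicalType} (phi : chart R n T)
    (f : T -> 'rV[R]_m) p w :
  normal_part phi f p w = w *m normal_proj (frame phi f p).
Proof.
rewrite /normal_part mulmxBr mulmx1 -induced_metricE; congr (_ - _).
rewrite exchange_big !mulmxA [RHS]mulmx_sum_row; apply: eq_bigr => l _.
rewrite -scaler_suml rowK; congr (_ *: _).
rewrite mxE; apply: eq_bigr => k _; rewrite mulrC; congr (_ * _).
by rewrite mxE; apply: eq_bigr => j _; rewrite !mxE.
Qed.

(** This is [n] times the mean curvature vector, computed in a prescribed chart instead of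
    [chart_at p]. *)
Definition trace_second_fundamental_form {T : topologicalType}
    (phi : chart R n T) (f : T -> 'rV[R]_m) (p : T) : 'rV[R]_m :=
  \sum_i \sum_j invmx (induced_metric phi f p) i j *:
    second_fundamental_form phi f i j p.

Lemma trace_second_fundamental_formE {T : topologicalType}
    (phi : chart R n T) (f : T -> 'rV[R]_m) (p : T) (E := frame phi f p) :
  trace_second_fundamental_form phi f p =
  \sum_i \sum_j invmx (E *m E^T) i j *:
    (pderiv phi i (pderiv phi j f) p *m normal_proj E).
Proof.
apply: eq_bigr => i _; apply: eq_bigr => j _.
by rewrite /second_fundamental_form normal_partE induced_metricE.
Qed.

Lemma smooth_map_differentiable (M : manifold R n) (W : normedModType R)
    (f : M -> W) (phi : chart R n M) u :
  smooth_map f -> atlas phi -> chart_cod phi u ->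
  differentiable (f \o chart_inv phi) u.
Proof. by move=> sf aphi cu; have [+ _] := sf phi aphi 1; apply. Qed.

Lemma differentialE (M : manifold R n) (f : M -> 'rV[R]_m) (phi : chart R n M)
    p v : smooth_map f -> atlas phi -> chart_dom phi p ->
  differential phi f p v = v *m frame phi f p.
Proof.
move=> sf aphi dp; rewrite /differential diff_row_sum mulmx_sum_row.
apply: eq_bigr => a _; rewrite rowK /pderiv deriveE//.
by apply: smooth_map_differentiable => //; exact: chart_cod_map.
Qed.

Lemma induced_metric_unitmx (M : manifold R n) (f : M -> 'rV[R]_m)
    (phi : chart R n M) p : immersion f -> atlas phi -> chart_dom phi p ->
  induced_metric phi f p \in unitmx.
Proof.
move=> [sf injf] aphi dp; rewrite induced_metricE; apply: gram_unitmx => v vE.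
by apply: (injf phi p aphi dp); rewrite !differentialE// vE mul0mx.
Qed.

(* The change of charts adds to the second derivatives a tangent vector, which
   the normal projection kills; the remaining term is tensorial. *)
Lemma trace_second_fundamental_form_chart (M : manifold R n)
    (f : M -> 'rV[R]_m) (phi psi : chart R n M) p :
  immersion f -> atlas phi -> atlas psi ->
  chart_dom phi p -> chart_dom psi p ->
  trace_second_fundamental_form phi f p =
  trace_second_fundamental_form psi f p.
Proof.
move=> imf aphi apsi dphi dpsi; have [sf _] := imf.
pose tau := psi \o chart_inv phi; pose Y := f \o chart_inv psi.
pose W := phi @` (chart_dom phi `&` chart_dom psi).
have stau : smooth_on W tau by exact: atlas_smooth.
have nW := near_chart_overlap dphi dpsi.
have tauW z : W z -> chart_cod psi (tau z).
  by case=> q [dq dq'] <-; rewrite /tau /= chart_mapK//; exact: chart_cod_map.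
have fE : {near phi p, f \o chart_inv phi =1 Y \o tau}.
  apply: filterS nW => _ [q [dq dq'] <-].
  by rewrite /Y /tau /= chart_mapK// chart_mapK.
have Wp : W (phi p) by exact: nbhs_singleton nW.
have taup : tau (phi p) = psi p by rewrite /tau /= chart_mapK.
(* From here on the transition map enters only through its smoothness, its range, its value at
   [phi p] and [fE]. *)
clearbody tau.
have dtau z : W z -> differentiable tau z by move=> Wz; exact: (stau 1).1.
have dY z : W z -> differentiable Y (tau z).
  by move=> Wz; apply: smooth_map_differentiable => //; exact: tauW.
pose e (i : 'I_n) : 'rV[R]_n := delta_mx 0 i.
pose J : 'M[R]_n := \matrix_(i, a) ('D_(e i) tau (phi p)) 0 a.
have frameE : frame phi f p = J *m frame psi f p.
  apply/row_matrixP => i; rewrite rowK row_mul mulmx_sum_row.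
  rewrite /pderiv (near_eq_derive _ fE) derive_comp_row//; [|exact: dtau|exact: dY].
  by apply: eq_bigr => a _; rewrite !rowK taup.
have uG := induced_metric_unitmx imf apsi dpsi.
(* The Gram matrix in [phi] is invertible and has [J] as a factor. *)
have uJ : J \in unitmx.
  have := induced_metric_unitmx imf aphi dphi.
  by rewrite induced_metricE frameE gram_mull !unitmx_mul => /andP[/andP[]].
rewrite induced_metricE in uG.
pose c (i j : 'I_n) := \sum_a ('D_(e i) ('D_(e j) tau) (phi p)) 0 a *:
  row a (frame psi f p).
rewrite !trace_second_fundamental_formE frameE.
apply: (trace_normal_proj_mull (c := c)
  (B := fun b a => pderiv psi b (pderiv psi a f) p) uG uJ).
- move=> i j; rewrite mulmx_suml big1// => a _.
  by rewrite -scalemxAl -row_mul normal_proj_tangent// row0 scaler0.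
move=> i j; rewrite pderiv_pderiv//.
(* The identity [fE] holds near every point close to [phi p], so the first derivatives agree near
   [phi p] and can be differentiated again. *)
rewrite (@near_eq_derive _ _ _ _ ('D_(e j) (Y \o tau))); last first.
  have := near_join fE; apply: filterS => z; exact: near_eq_derive.
rewrite derive2_comp_row.
- rewrite taup big_split/=; apply: (f_equal2 +%R); apply: eq_bigr => a _.
    by rewrite /frame rowK.
  rewrite [J j a]mxE; apply: f_equal; apply: eq_bigr => b _.
  by rewrite [J i b]mxE; apply: f_equal; rewrite pderiv_pderiv.
- by apply: filterS nW => z Wz; split; [exact: dtau|exact: dY].
- by have [_ /(_ (e j))[+ _]] := stau 2; apply.
- move=> a; have [_ /(_ (e a))[+ _]] := sf psi apsi 2; apply.
  exact: tauW.
Qed.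

End Immersions.

(** * Conformal maps of surfaces *)

(** In a fixed chart the trace is built algebraically from first and second derivatives of [f] and
    the inverse of an invertible Gram matrix. *)
Lemma smooth_trace_second_fundamental_form (R : realType) (n m : nat)
    (M : manifold R n) (f : M -> 'rV[R]_m) (phi : chart R n M) :
  immersion f -> atlas phi ->
  smooth_on (chart_cod phi)
    (trace_second_fundamental_form phi f \o chart_inv phi).
Proof.
move=> imf aphi k; have [sf _] := imf.
have oU : open (chart_cod phi) by exact: chart_cod_open.
have C1 i : Ck_on k (chart_cod phi) (fun z => pderiv phi i f (chart_inv phi z)).
  have [_ /(_ (delta_mx 0 i)) Cf] := sf phi aphi k.+1.
  apply: (Ck_on_ext oU _ Cf) => z /set_mem cz.
  exact: (esym (pderiv_inv _ _ cz)).
have C2 i j : Ck_on k (chart_cod phi)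
    (fun z => pderiv phi i (pderiv phi j f) (chart_inv phi z)).
  have [_ /(_ (delta_mx 0 j)) [_ /(_ (delta_mx 0 i)) Cf]] := sf phi aphi k.+2.
  apply: (Ck_on_ext oU _ Cf) => z /set_mem cz; apply: esym.
  apply: (etrans (pderiv_pderiv _ _ _ (chart_inv_dom cz))).
  by rewrite (chart_invK cz).
have CI i j : Ck_on k (chart_cod phi)
    (fun z => invmx (induced_metric phi f (chart_inv phi z)) i j).
  apply: Ck_on_invmx => // [z /chart_inv_dom|a b].
    exact: induced_metric_unitmx.
  by under eq_fun do rewrite mxE; exact: Ck_on_dotv.
apply: Ck_on_sum => // i; apply: Ck_on_sum => // j.
apply: Ck_onZ => //; apply: Ck_onB => //.
apply: Ck_on_sum => // a; apply: Ck_on_sum => // b.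
by apply: Ck_onZ => //; apply: Ck_onM => //; exact: Ck_on_dotv.
Qed.

Lemma metric_unitmx (R : realType) (n : nat) (M : manifold R n) (g : metric M)
    (phi : chart R n M) p : atlas phi -> chart_dom phi p ->
  g phi p \in unitmx.
Proof.
move=> aphi dp; rewrite -row_free_unit; apply: inj_row_free => v vg.
apply/eqP/negPn/negP => v0; have := metric_pos g aphi dp v0.
by rewrite /bilin vg mul0mx mxE ltxx.
Qed.

Lemma bilin_delta (R : realType) (n : nat) (G : 'M[R]_n) i j :
  bilin G (delta_mx 0 i) (delta_mx 0 j) = G i j.
Proof. by rewrite /bilin -rowE trmx_delta -colE !mxE. Qed.

(* Changing g to lam g changes the trace of the Christoffel symbols by
   (1 - n/2) grad (ln lam), which vanishes in dimension n = 2. *)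
Lemma christoffel_trace_conformal (R : realType) (g : 'M[R]_2) (lam : R)
    (dlam : 'I_2 -> R) (dg b : 'I_2 -> 'I_2 -> 'I_2 -> R) k :
  g \in unitmx -> g^T = g -> lam != 0 ->
  (forall i j l, b i j l = b j i l) ->
  (forall i j l, dlam i * g j l + lam * dg i j l = b i j l + b i l j) ->
  \sum_i \sum_j invmx g i j * (2^-1 * (dg i j k + dg j i k - dg k i j)) =
  \sum_i \sum_j invmx g i j * (lam^-1 * b i j k).
Proof.
move=> ug gT lam0 bC dgE; set h := invmx g.
have hT i j : h j i = h i j by rewrite /h -{1}gT -trmx_inv mxE.
have gC i j : g j i = g i j by rewrite -{1}gT mxE.
have hg i l : \sum_j h i j * g j l = (i == l)%:R.
  by have /matrixP/(_ i l) := mulVmx ug; rewrite !mxE.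
have dlamE i : \sum_l dlam l * (l == i)%:R = dlam i.
  rewrite (bigD1 i)//= eqxx mulr1 big1 ?addr0// => l /negPf->.
  by rewrite mulr0.
have t1 : \sum_i \sum_j h i j * (dlam i * g j k) = dlam k.
  rewrite -[RHS]dlamE; apply: eq_bigr => i _; rewrite -hg mulr_sumr.
  by apply: eq_bigr => j _; rewrite mulrCA.
have t2 : \sum_i \sum_j h i j * (dlam j * g i k) = dlam k.
  rewrite exchange_big -[RHS]dlamE; apply: eq_bigr => j _; rewrite -hg mulr_sumr.
  by apply: eq_bigr => i _; rewrite mulrCA hT.
(* Here the dimension enters: the trace of the identity is 2, which cancels the two contributions
   [t1] and [t2]. *)
have t3 : \sum_i \sum_j h i j * (dlam k * g i j) = 2 * dlam k.
  transitivity (\sum_(i < 2) dlam k).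
    apply: eq_bigr => i _; rewrite -[RHS]mulr1.
    have <- : \sum_j h i j * g j i = 1 by rewrite hg eqxx.
    by rewrite mulr_sumr; apply: eq_bigr => j _; rewrite mulrCA gC.
  by rewrite sumr_const card_ord mulr_natl.
(* Solving [dgE] for [dg], the six terms in [b] collapse by symmetry to [2 * b i j k], as in
   Koszul's formula; only the traces of [dlam] remain. *)
have -> : \sum_i \sum_j h i j * (2^-1 * (dg i j k + dg j i k - dg k i j)) =
    \sum_i \sum_j h i j * (lam^-1 * b i j k) - (2 * lam)^-1 *
    (\sum_i \sum_j h i j * (dlam i * g j k) +
     \sum_i \sum_j h i j * (dlam j * g i k) -
     \sum_i \sum_j h i j * (dlam k * g i j)).
  rewrite -big_split -sumrB mulr_sumr -sumrB; apply: eq_bigr => i _ /=.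
  rewrite -big_split -sumrB mulr_sumr -sumrB; apply: eq_bigr => j _ /=.
  have dgE' a c l : dg a c l = lam^-1 * (b a c l + b a l c - dlam a * g c l).
    by rewrite -dgE addrAC subrr add0r mulKf.
  by rewrite !dgE' (bC k i j) (bC k j i) (bC j i k); field.
by rewrite t1 t2 t3; ring.
Qed.

(** Moves the trace inside the raising of the index, since Christoffel symbols of conformal metrics
    are comparable here only after tracing. *)
Lemma trace_contraction (R : comRingType) (V : lmodType R) (n : nat)
    (h a : 'I_n -> 'I_n -> R) (c : 'I_n -> 'I_n -> 'I_n -> R) (e : 'I_n -> V) :
  \sum_i \sum_j h i j *: \sum_k (\sum_l a k l * c i j l) *: e k =
  \sum_k (\sum_l a k l * \sum_i \sum_j h i j * c i j l) *: e k.
Proof.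
transitivity (\sum_k \sum_i \sum_j (h i j * \sum_l a k l * c i j l) *: e k).
  rewrite [RHS]exchange_big; apply: eq_bigr => i _; rewrite [RHS]exchange_big.
  apply: eq_bigr => j _; rewrite scaler_sumr; apply: eq_bigr => k _.
  by rewrite scalerA.
apply: eq_bigr => k _.
under eq_bigr => i _ do rewrite -scaler_suml.
rewrite -scaler_suml; congr (_ *: _).
under [RHS]eq_bigr => l _ do rewrite mulr_sumr.
rewrite [RHS]exchange_big; apply: eq_bigr => i _.
under [RHS]eq_bigr => l _ do rewrite mulr_sumr.
rewrite [RHS]exchange_big; apply: eq_bigr => j _; rewrite mulr_sumr.
by apply: eq_bigr => l _; rewrite mulrCA.
Qed.

(** Both sides contain the same second derivatives of [f]. What is subtracted is the Christoffel
    term of [g] on the left and the tangential part, that is the Christoffel term of [lam g], on the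
    right; their traces agree by [christoffel_trace_conformal]. *)
Lemma trace_hessian_conformal (R : realType) (m : nat) (M : manifold R 2)
    (g : metric M) (f : M -> 'rV[R]_m) (lam : M -> R) (phi : chart R 2 M) p :
  smooth_map f -> atlas phi -> chart_dom phi p ->
  (forall q, chart_dom phi q -> induced_metric phi f q = lam q *: g phi q) ->
  lam p != 0 ->
  \sum_i \sum_j invmx (g phi p) i j *: hessian phi (g phi) f i j p =
  \sum_i \sum_j invmx (g phi p) i j *: second_fundamental_form phi f i j p.
Proof.
move=> sf aphi dp IE lam0; pose u := phi p.
have cu : chart_cod phi u := chart_cod_map dp.
have nU := near_chart_cod cu.
pose F := f \o chart_inv phi; pose G z := g phi (chart_inv phi z).
pose Lam z := lam (chart_inv phi z).
pose D (i : 'I_2) (W : normedModType R) (h : 'rV[R]_2 -> W) :=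
  'D_(delta_mx 0 i : 'rV[R]_2) h.
have invu : chart_inv phi u = p by rewrite chart_mapK.
have CF : Ck_on 2 (chart_cod phi) F by exact: sf.
have dDF i z : chart_cod phi z -> differentiable (D i _ F) z.
  exact: (CF.2 _).1.
have GE j k z : chart_cod phi z ->
    dotv (D j _ F z) (D k _ F z) = Lam z * G z j k.
  move=> cz; have /matrixP/(_ j k) := IE _ (chart_inv_dom cz).
  by rewrite !mxE !pderiv_inv.
have dG j k z : chart_cod phi z -> differentiable (fun z => G z j k) z.
  move=> cz; have [+ _] := metric_smooth g aphi 1 => /(_ _ cz) dg.
  exact: (@differentiable_comp _ _ _ _ _ (fun A : 'M[R]_2 => A j k : R) z dg
    (differentiable_coord (G z) j k)).
(* No regularity of [lam] is assumed: near [u] it is the quotient of the squared length of the first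
   coordinate vector of [f] by the positive coefficient [G z 0 0]. *)
have dLam : differentiable Lam u.
  have G0 z : chart_cod phi z -> G z 0 0 != 0.
    move=> cz; rewrite -bilin_delta gt_eqF//.
    apply: metric_pos => //; first exact: chart_inv_dom.
    by apply/eqP => /matrixP/(_ 0 0); rewrite !mxE => /eqP; rewrite oner_eq0.
  pose Q z := dotv (D 0 _ F z) (D 0 _ F z) * (G z 0 0)^-1.
  apply: (@near_eq_differentiable _ _ _ Q).
    by apply: filterS nU => z cz; rewrite /Q GE// mulfK// G0.
  apply: differentiableM; last by apply: differentiableV; [exact: dG|exact: G0].
  have C1 : Ck_on 1 (chart_cod phi) (D 0 _ F) by exact: CF.2.
  have := Ck_on_dotv (chart_cod_open (c := phi)) C1 C1.
  by move=> [+ _]; apply.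
pose b i j k := dotv (D i _ (D j _ F) u) (D k _ F u).
pose dg i j k := pderiv phi i (fun q => g phi q j k : R^o) p.
have bC i j k : b i j k = b j i k.
  by rewrite /b /D (derive_comm_row _ _ (chart_cod_open (c := phi)) CF cu).
(* Both sides of [GE] are differentiated by the product rule. *)
have dgE i j k : D i _ Lam u * g phi p j k + lam p * dg i j k =
    b i j k + b i k j.
  have E : D i _ (fun z => dotv (D j _ F z) (D k _ F z)) u =
      D i _ (fun z => Lam z * G z j k) u.
    by apply: near_eq_derive; apply: filterS nU => z; exact: GE.
  rewrite /D derive_dotv in E; [|exact: dDF..].
  rewrite deriveM in E; [|by apply: diff_derivable => //; exact: dG..].
  rewrite {2}/b dotvC; apply: (etrans _ (esym E)).
  rewrite addrC -[in lam p]invu -[in g phi p]invu.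
  by apply: (f_equal2 +%R) => //; exact: mulrC.
have ug := metric_unitmx g aphi dp.
have gT := Defs.metric_sym g aphi dp.
have hT i j : invmx (g phi p) j i = invmx (g phi p) i j.
  by rewrite -{1}gT -trmx_inv mxE.
have bE i j k : dotv (pderiv phi i (pderiv phi j f) p) (pderiv phi k f p) =
    b i j k.
  by rewrite pderiv_pderiv.
have sumB (B X : 'I_2 -> 'I_2 -> 'rV[R]_m) :
    \sum_i \sum_j invmx (g phi p) i j *: (B i j - X i j) =
    \sum_i \sum_j invmx (g phi p) i j *: B i j -
    \sum_i \sum_j invmx (g phi p) i j *: X i j.
  rewrite -sumrB; apply: eq_bigr => i _; rewrite -sumrB; apply: eq_bigr => j _.
  exact: scalerBr.
apply: (etrans (sumB _ _)); apply: (etrans _ (esym (sumB _ _))).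
apply: f_equal; apply: f_equal.
transitivity (\sum_i \sum_j invmx (g phi p) i j *: \sum_k
    (\sum_l invmx (g phi p) k l * (2^-1 * (dg i j l + dg j i l - dg l i j)))
      *: pderiv phi k f p).
  apply: eq_bigr => i _; apply: eq_bigr => j _; congr (_ *: _).
  apply: eq_bigr => k _; congr (_ *: _); rewrite /christoffel mulr_sumr.
  by apply: eq_bigr => l _; rewrite mulrCA.
(* The tangential part uses the inverse of the induced metric [lam g], whence the factor
   [(lam p)^-1]. *)
transitivity (\sum_i \sum_j invmx (g phi p) i j *: \sum_k
    (\sum_l invmx (g phi p) k l * ((lam p)^-1 * b i j l))
      *: pderiv phi k f p); last first.
  apply: eq_bigr => i _; apply: eq_bigr => j _; congr (_ *: _).
  rewrite [RHS]exchange_big; apply: eq_bigr => k _; rewrite scaler_suml.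
  apply: eq_bigr => l _; congr (_ *: _).
  rewrite bE IE// invmxZ ?unitmxZ ?unitfE// [in RHS]mxE hT.
  by rewrite mulrCA mulrA.
rewrite !trace_contraction; apply: eq_bigr => k _; congr (_ *: _).
apply: eq_bigr => l _; congr (_ * _).
exact: christoffel_trace_conformal dgE.
Qed.

(** * The Laplace map and the mean curvature of conformal maps *)

Lemma induced_metricZ (R : realType) (n m : nat) (M : manifold R n)
    (g : metric M) (f : M -> 'rV[R]_m) (c : R) (phi : chart R n M) p :
  smooth_map f -> atlas phi -> chart_dom phi p ->
  (forall X Y, dotv (differential phi f p X) (differential phi f p Y) =
    c * bilin (g phi p) X Y) ->
  induced_metric phi f p = c *: g phi p.
Proof.
move=> sf aphi dp fE; apply/matrixP => i j; rewrite !mxE -bilin_delta -fE.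
by rewrite !differentialE// -!rowE !rowK.
Qed.

(** Beltrami's formula, Delta x = -2H. *)
Lemma laplacian_isometric (R : realType) (m : nat) (M : manifold R 2)
    (g : metric M) (x : M -> 'rV[R]_m) p : isometric_immersion g x ->
  laplacian g x p = - trace_second_fundamental_form (chart_at p) x p.
Proof.
move=> [imx isox]; have [sx _] := imx.
have aphi := chart_at_atlas p; have dp := chart_at_dom p.
have IE q : chart_dom (chart_at p) q ->
    induced_metric (chart_at p) x q = 1 *: g (chart_at p) q.
  by move=> dq; apply: induced_metricZ => // X Y; rewrite mul1r; exact: isox.
rewrite /laplacian (trace_hessian_conformal (lam := fun=> 1) sx)//.
  by rewrite /trace_second_fundamental_form IE// scale1r.
exact: oner_neq0.
Qed.

(** Chart independence lets the trace in the fixed chart [phi], which is smooth, replace the one in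
    the chart that varies with the point. *)
Lemma smooth_laplacian_isometric (R : realType) (m : nat) (M : manifold R 2)
    (g : metric M) (x : M -> 'rV[R]_m) :
  isometric_immersion g x -> smooth_map (laplacian g x).
Proof.
move=> isox phi aphi k; have [imx _] := isox.
have oU : open (chart_cod phi) by exact: chart_cod_open.
apply: (Ck_on_ext oU _ (Ck_onB oU (Ck_on_cst k _ 0)
  (smooth_trace_second_fundamental_form imx aphi k))) => z /set_mem cz.
apply: (etrans (sub0r _)).
apply: (etrans _ (esym (laplacian_isometric _ isox))); apply: f_equal.
apply: trace_second_fundamental_form_chart => //.
- exact: chart_at_atlas.
- exact: chart_inv_dom.
- exact: chart_at_dom.
Qed.

(** The pulled-back inner product is a positive multiple of [g], hence definite, so the differential
    has no kernel. *)
Lemma conformal_immersion (R : realType) (n m : nat) (M : manifold R n)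
    (g : metric M) (f : M -> 'rV[R]_m) :
  smooth_map f -> conformal g f -> immersion f.
Proof.
move=> sf [rho rho0 fE]; split=> // phi p aphi dp X Y XY.
apply/eqP; rewrite -subr_eq0; apply/negPn/negP => XY0.
have := fE phi p (X - Y) (X - Y) aphi dp.
rewrite {1 2}/differential linearB -/(differential phi f p X).
rewrite -/(differential phi f p Y) XY subrr {1}/dotv big1; last first.
  by move=> k _; rewrite mxE mul0r.
by move/esym/eqP; rewrite gt_eqF// mulr_gt0 ?exprn_gt0// metric_pos.
Qed.

Lemma mean_curvature_conformal (R : realType) (m : nat) (M : manifold R 2)
    (g : metric M) (f : M -> 'rV[R]_m) : smooth_map f -> conformal g f ->
  forall p, exists2 c : R, c != 0 & mean_curvature f p = c *: laplacian g f p.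
Proof.
move=> sf [rho rho0 fE] p.
have aphi := chart_at_atlas p; have dp := chart_at_dom p.
have IE q : chart_dom (chart_at p) q ->
    induced_metric (chart_at p) f q = rho q ^+ 2 *: g (chart_at p) q.
  by move=> dq; apply: induced_metricZ => // X Y; exact: fE.
have r0 : rho p ^+ 2 != 0 by rewrite expf_neq0// gt_eqF.
(* The 1/2 normalizes the mean curvature, [rho^-2] comes from the inverse of the induced metric, and
   the sign from Delta = - trace. *)
exists (- (2^-1 * (rho p ^+ 2)^-1)).
  by rewrite oppr_eq0 mulf_neq0// invr_eq0 ?pnatr_eq0.
rewrite /laplacian (trace_hessian_conformal (lam := fun q => rho q ^+ 2) sf)//.
rewrite scalerN scaleNr opprK /mean_curvature -scalerA; congr (_ *: _).
rewrite scaler_sumr; apply: eq_bigr => i _.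
rewrite scaler_sumr; apply: eq_bigr => j _.
rewrite IE// invmxZ; last by rewrite unitmxZ ?unitfE//; exact: metric_unitmx.
by rewrite [in LHS]mxE scalerA.
Qed.

Theorem proposition2p1 (R : realType) (m : nat) (M : manifold R 2)
    (g : metric M) (x : M -> 'rV[R]_m) :
  isometric_immersion g x ->
  conformal g (laplace_map g x) ->
  (minimal_immersion (laplace_map g x) <-> biharmonic g x).
Proof.
move=> isox confL; have sL := smooth_laplacian_isometric isox.
(* As [laplace_map g x] unfolds to [laplacian g x], this makes the mean curvature of L a nonzero
   multiple of Delta^2 x at each point. *)
have HL := mean_curvature_conformal sL confL.
split=> [[_ minL] p|bihx].
  have [c c0 HE] := HL p; have /eqP := minL p.
  by rewrite HE scaler_eq0 (negPf c0) => /eqP.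
(* Minimality includes that L is an immersion, which comes from conformality. *)
split=> [|p]; first exact: conformal_immersion confL.
by have [c _ HE] := HL p; rewrite [LHS]HE bihx scaler0.
Qed.
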